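(* For every integer $n\ge 0$, every nonzero complex root of the Yablonskii--Vorob'ev polynomial $Q_n$ is irrational, i.e. is not an element of $\mathbb{Q}$.
   Context: The Yablonskii--Vorob'ev polynomials $Q_n$ ($n\ge 0$) are defined by $Q_0=1$, $Q_1=z$ and the differential-difference equation $Q_{n+1}Q_{n-1}=zQ_n^2-4\left(Q_nQ_n''-(Q_n')^2\right)$ for $n\ge1$, where $'$ denotes $d/dz$. It is known that each $Q_n$ is a monic polynomial in $z$ of degree $\frac12 n(n+1)$ with integer coefficients. *)

(* Defs.v *)
From mathcomp Require Import all_boot all_order all_algebra.
Set Implicit Arguments.
Unset Strict Implicit.
Unset Printing Implicit Defensive.
Import GRing.Theory.
Local Open Scope ring_scope.

(* The equations determine Q uniquely: by induction on n they force Q n to be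
   monic of degree n(n+1)/2, so Q n.-1 can be cancelled.  That all the
   divisions are exact, i.e. that such a sequence of polynomials exists, is
   the classical polynomiality of the Yablonskii-Vorob'ev recursion. *)
Definition yablonskii_vorobev (F : fieldType) (Q : nat -> {poly F}) : Prop :=
  [/\ Q 0%N = 1,
      Q 1%N = 'X
    & forall n : nat, (1 <= n)%N ->
        Q n.+1 * Q n.-1 =
          'X * Q n ^+ 2 - 4%:R *: (Q n * (Q n)^`()^`() - ((Q n)^`()) ^+ 2)].

(* Main.v *)
(* Let c be a cube root of 4.  The rescaled polynomials T_n(s) = c^(-d_n) Q_n(c s),
   with d_n = n(n+1)/2, satisfy the recurrence with the factor 4 removed, so they
   are monic with integer coefficients: each one is an exact quotient by a monic
   integer polynomial.  Choosing another cube root of 4 gives the same integer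
   polynomials, hence T_n(w s) = w^(d_n) T_n(s) for a primitive cube root of unity
   w, and T_n(0) = 0 when n = 1 mod 3.  Modulo 2 the second derivatives vanish, and
   the first few coefficients can be followed through the recurrence: the lowest
   one (T_n(0), or T_n'(0) when n = 1 mod 3) is always odd.  If z = q is a nonzero
   rational root of Q_n, then s = q / c is a root of a monic integer polynomial with
   odd constant term, although s^3 = q^3 / 4 has nonzero 2-adic valuation: a positive
   valuation contradicts the odd constant term, a negative one the integrality of s. *)
Require Import Defs.
From mathcomp Require Import all_boot all_order all_algebra.
From mathcomp Require Import ring zify.
From mathcomp Require Import complex.
From mathcomp Require Import reals.
Import GRing.Theory Num.Theory.
Local Open Scope ring_scope.

(** * The rescaled recurrence and its exact divisions over the integers *)

Definition yv_rhs {A : comNzRingType} (p : {poly A}) : {poly A} :=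
  'X * p ^+ 2 - (p * p^`()^`() - p^`() ^+ 2).

Lemma map_yv_rhs (A B : comNzRingType) (f : {rmorphism A -> B}) (p : {poly A}) :
  map_poly f (yv_rhs p) = yv_rhs (map_poly f p).
Proof.
by rewrite /yv_rhs !expr2 !rmorphB !rmorphM /= map_polyX -!deriv_map.
Qed.

(** The leading term comes from ['X * p ^+ 2], of degree [2 deg p + 1]; the products of [p] and its
    derivatives stay strictly below. *)
Lemma monic_yv_rhs (A : comNzRingType) (p : {poly A}) :
  p \is monic -> yv_rhs p \is monic.
Proof.
move=> mon_p; have p_gt0 : (0 < size p)%N by rewrite size_poly_gt0 monic_neq0.
have mon_lead : 'X * p ^+ 2 \is monic by rewrite rpredM ?monicX ?rpredX.
have size_lead : size ('X * p ^+ 2) = (size p + size p)%N.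
  rewrite size_monicM ?monicX ?monic_neq0 ?rpredX // size_polyX.
  by rewrite expr2 size_monicM ?monic_neq0 //; case: (size p) p_gt0.
have szM (q r : {poly A}) : (size q <= size p)%N -> (size r <= size p)%N ->
    (size (q * r)%R < size p + size p)%N.
  move=> hq hr; apply: leq_ltn_trans (size_polyMleq _ _) _.
  apply: (@leq_ltn_trans (size p + size p).-1); last first.
    by rewrite prednK ?addn_gt0 ?p_gt0.
  by rewrite -!subn1 leq_sub2r // leq_add.
have szD (q : {poly A}) : (size q <= size p)%N -> (size q^`() <= size p)%N.
  by apply: leq_trans; rewrite /deriv (leq_trans (size_poly _ _)) ?leq_pred.
rewrite monicE /yv_rhs lead_coefDl -?monicE // size_lead size_polyN.
apply: leq_ltn_trans (size_polyD _ _) _.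
by rewrite gtn_max size_polyN expr2 !szM ?szD.
Qed.

Fixpoint yv_pair (n : nat) : {poly int} * {poly int} :=
  if n is m.+1 then
    let: (p, q) := yv_pair m in (q, Pdiv.Ring.rdivp (yv_rhs q) p)
  else (1, 'X).

Definition yv_int (n : nat) : {poly int} := (yv_pair n).1.

Lemma yv_intSS n :
  yv_int n.+2 = Pdiv.Ring.rdivp (yv_rhs (yv_int n.+1)) (yv_int n).
Proof. by rewrite /yv_int /=; case: (yv_pair n). Qed.

(** Uniqueness of division by a monic polynomial, compared in [B], kills the remainder computed in
    [A]: exactness descends from a field to the integers. *)
Lemma rdivp_map_monic {A B : comNzRingType} {f : {rmorphism A -> B}}
    {p d : {poly A}} {q : {poly B}} :
  injective f -> d \is monic -> map_poly f p = q * map_poly f d ->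
  q = map_poly f (Pdiv.Ring.rdivp p d) /\ p = Pdiv.Ring.rdivp p d * d.
Proof.
move=> f_inj mon_d def_p; have p_eq := Pdiv.RingMonic.rdivp_eq mon_d p.
set a := Pdiv.Ring.rdivp p d in p_eq *; set r := Pdiv.Ring.rmodp p d in p_eq.
have fr : map_poly f r = (q - map_poly f a) * map_poly f d.
  by rewrite mulrBl -def_p {1}p_eq rmorphD rmorphM /= addrC addKr.
(* Otherwise the right-hand side of [fr] would be of degree at least that of [d]. *)
have q_eq : q = map_poly f a.
  apply/eqP; rewrite -subr_eq0; apply/negPn/negP => nz.
  have := congr1 (fun u : {poly B} => size u) fr.
  rewrite size_map_inj_poly ?rmorph0 // size_Mmonic ?monic_map //.
  rewrite size_map_inj_poly ?rmorph0 //.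
  have : (size r < size d)%N by rewrite Pdiv.Ring.ltn_rmodpN0 ?monic_neq0.
  move=> + eq_r; rewrite eq_r ltnNge; case/negP.
  have : (0 < size (q - map_poly f a)%R)%N by rewrite size_poly_gt0.
  by case: (size (q - _)) => // k _; rewrite addSn leq_addl.
split=> //; rewrite {1}p_eq; suff -> : r = 0 by rewrite addr0.
apply: (map_inj_poly f_inj (rmorph0 f)).
by rewrite fr q_eq subrr mul0r rmorph0.
Qed.

Section Integrality.
Variables (F : numFieldType) (T : nat -> {poly F}).
Hypotheses (T0 : T 0%N = 1) (T1 : T 1%N = 'X).
Hypothesis TE : forall n, T n.+2 * T n = yv_rhs (T n.+1).

(** The field sequence [T] certifies that the integer divisions are exact; the resulting integer
    recurrence can then be reduced modulo 2. *)
Lemma yv_int_spec n :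
  [/\ T n = map_poly intr (yv_int n), yv_int n \is monic
    & yv_int n.+2 * yv_int n = yv_rhs (yv_int n.+1)].
Proof.
suff H : [/\ T n = map_poly intr (yv_int n), T n.+1 = map_poly intr (yv_int n.+1),
    yv_int n \is monic & yv_int n.+1 \is monic].
  case: H => Tn Tn1 mon_n mon_n1; split=> //.
  have := TE n; rewrite Tn Tn1 -map_yv_rhs => /esym.
  by case/(rdivp_map_monic (@intr_inj F) mon_n) => _; rewrite -yv_intSS.
elim: n => [|n [Tn Tn1 mon_n mon_n1]].
  by rewrite T0 T1 /yv_int /= rmorph1 map_polyX monicX monic1.
have := TE n; rewrite Tn Tn1 -map_yv_rhs => /esym.
case/(rdivp_map_monic (@intr_inj F) mon_n) => Tn2; rewrite -yv_intSS in Tn2 *.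
move=> rec; split=> //.
by rewrite -(monicMr _ mon_n) -rec monic_yv_rhs.
Qed.

End Integrality.

(** The binomial exponent is the degree [n(n+1)/2]. Rescaling multiplies ['X] by [c] and two
    derivatives by [c^-2], so both terms get the same factor when [4 c^-2 = c]. *)
Lemma scaled_recurrence (F : fieldType) (Q : nat -> {poly F}) (c : F) :
  c ^+ 3 = 4%:R -> c != 0 -> yablonskii_vorobev Q ->
  let T : nat -> {poly F} :=
    fun n => c ^- 'C(n.+1, 2) *: (Q n \Po (c *: 'X)) in
  [/\ T 0%N = 1, T 1%N = 'X & forall n, T n.+2 * T n = yv_rhs (T n.+1)].
Proof.
move=> c3 c0 [Q0 Q1 rec] T; split.
- by rewrite /T Q0 bin_small // expr0 invr1 scale1r -polyC1 comp_polyC.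
- by rewrite /T Q1 comp_polyX binn expr1 scalerA mulVf // scale1r.
move=> n; have := congr1 (fun p => p \Po (c *: 'X)) (rec n.+1 isT).
have QT k : Q k \Po (c *: 'X) = c ^+ 'C(k.+1, 2) *: T k.
  by rewrite scalerA mulfV ?scale1r // expf_neq0.
have dQ (p : {poly F}) : (p^`() \Po (c *: 'X)) = c^-1 *: (p \Po (c *: 'X))^`().
  rewrite deriv_comp derivZ derivX -scalerAr mulr1 scalerA mulVf // scale1r //.
have expD : c ^+ 'C(n.+3, 2) * c ^+ 'C(n.+1, 2) =
    c * (c ^+ 'C(n.+2, 2) * c ^+ 'C(n.+2, 2)).
  rewrite -!exprD -exprS; congr (_ ^+ _).
  have := binS n.+2 1; have := binS n.+1 1; rewrite !bin1; lia.
clearbody T; rewrite /= !expr2 !(rmorphB, rmorphM) /= comp_polyZ !(rmorphB, rmorphM) /=.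
rewrite !dQ !derivZ !QT comp_polyX !derivZ.
rewrite -!scalerAl -!scalerAr !scalerA expD.
set u := c ^+ 'C(n.+2, 2).
have -> : u * (c^-1 / c * u) = c^-1 * u * (c^-1 * u) by ring.
have E : 4%:R * (c^-1 * u * (c^-1 * u)) = c * (u * u) by rewrite -c3; field.
rewrite -scalerBr scalerA E -scalerBr; apply: scalerI.
by rewrite !mulf_neq0 // expf_neq0.
Qed.

(** * Lowest coefficients modulo 2 *)

Section ModTwo.

Lemma mulrn_F2 (x : 'F_2) (m : nat) : ~~ odd m -> x *+ m = 0.
Proof.
move=> /negbTE m_even; rewrite -(odd_double_half m) m_even -muln2 mulnC mulrnA.
by rewrite -[x *+ 2]mulr_natr (_ : 2%:R = 0) ?mulr0 ?mul0rn //; apply/eqP.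
Qed.

Lemma coef_yv_rhs_F2 (p : {poly 'F_2}) :
  [/\ (yv_rhs p)`_0 = p`_1 ^+ 2, (yv_rhs p)`_1 = p`_0 ^+ 2 & (yv_rhs p)`_2 = 0].
Proof.
(* Each coefficient carries a product of two consecutive integers, which is even. *)
have d2 : p^`()^`() = 0.
  apply/polyP=> i; rewrite !coef_deriv coef0 -mulrnA mulrn_F2 //.
  by rewrite oddM /= negbK andbN.
rewrite /yv_rhs d2 mulr0 sub0r opprK !expr2.
split; rewrite coefD coefXM /= !coefM !big_ord_recr !big_ord0 /=;
  rewrite !add0r ?subn0 !coef_deriv.
- by rewrite !mulr1n.
- by rewrite (mulrn_F2 (p`_2)) // mulr0 mul0r !addr0.
rewrite (mulrn_F2 (p`_2)) // mulr0 addr0 [p`_1 * p`_0]mulrC -mulr2n mulrn_F2 // add0r.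
by rewrite [X in _ + X]mulrC -mulr2n mulrn_F2.
Qed.

Variable P : nat -> {poly 'F_2}.
Hypotheses (P0 : P 0%N = 1) (P1 : P 1%N = 'X).
Hypothesis PE : forall n, P n.+2 * P n = yv_rhs (P n.+1).

(** The low coefficients repeat with period 3; those listed are enough to close the induction. *)
Lemma yv_mod2_spec k :
  [/\ (P (3 * k))`_0 = 1, (P (3 * k))`_1 = 0, (P (3 * k).+1)`_0 = 0,
      (P (3 * k).+1)`_1 = 1 & (P (3 * k).+1)`_2 = 0] /\ (P (3 * k).+2)`_0 = 1.
Proof.
have coefs n : [/\ (P n.+2)`_0 * (P n)`_0 = (P n.+1)`_1 ^+ 2,
    (P n.+2)`_0 * (P n)`_1 + (P n.+2)`_1 * (P n)`_0 = (P n.+1)`_0 ^+ 2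
  & (P n.+2)`_0 * (P n)`_2 + (P n.+2)`_1 * (P n)`_1 + (P n.+2)`_2 * (P n)`_0 = 0].
  have := coef_yv_rhs_F2 (P n.+1).
  by rewrite -PE !coefM !big_ord_recr !big_ord0 /= !add0r.
suff H : [/\ (P (3 * k))`_0 = 1, (P (3 * k))`_1 = 0, (P (3 * k).+1)`_0 = 0,
      (P (3 * k).+1)`_1 = 1 & (P (3 * k).+1)`_2 = 0].
  split=> //; case: H => a0 _ _ b1 _; case: (coefs (3 * k)%N) => + _ _.
  by rewrite a0 b1 mulr1 expr1n.
elim: k => [|k [a0 a1 b0 b1 b2]].
  by rewrite muln0 P0 P1 !coefC !coefX.
have [c0 _ _] := coefs (3 * k)%N; rewrite a0 b1 mulr1 expr1n in c0.
(* Here the divisor vanishes at 0 with linear coefficient 1, so the next polynomial is read off one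
   degree higher, from the coefficients of degrees 1 and 2. *)
have [] := coefs (3 * k).+1; rewrite b0 b1 b2 c0 !mulr0 !mulr1 !addr0 add0r expr1n.
move=> /esym/eqP; rewrite sqrf_eq0 => /eqP c1 d0 d1.
have [] := coefs (3 * k).+2; rewrite c0 c1 d0 d1 !mulr0 !mulr1 !add0r expr0n expr1n /=.
move=> e0; rewrite e0 mul0r !add0r => e1 e2.
by rewrite mulnS.
Qed.

End ModTwo.

(** * The 2-adic obstruction *)

Lemma half_odd_not_integral (F : numFieldType) (a : int) (y : F) :
  a%:~R != 0 :> 'F_2 -> integralOver intr y -> a%:~R = 2%:R * y -> False.
Proof.
move=> a_odd [p mon_p /rootP py] aE.
have [d sp] : exists d, size p = d.+1.
  by exists (size p).-1; rewrite prednK // size_poly_gt0 monic_neq0.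
(* This integer is [2^d p(a/2)]; modulo 2 only its top term [a^d] survives. *)
have : \sum_(i < d.+1) p`_i * 2 ^+ (d - i) * a ^+ i = 0.
  apply/(@intr_inj F); rewrite rmorph_sum rmorph0 /=.
  transitivity (2%:R ^+ d * (map_poly intr p).[y]); last by rewrite py mulr0.
  rewrite horner_coef size_map_inj_poly //; last exact: intr_inj.
  rewrite sp mulr_sumr; apply: eq_bigr => i _.
  have -> : 2%:R ^+ d = 2%:R ^+ (d - i) * 2%:R ^+ i :> F.
    by rewrite -exprD subnK // -ltnS.
  by rewrite coef_map /= !rmorphM /= !rmorphXn /= aE exprMn; ring.
move/(congr1 (intr : int -> 'F_2)); rewrite rmorph0 rmorph_sum.
rewrite big_ord_recr /= big1 ?add0r.
  rewrite subnn expr0 mulr1 rmorphM rmorphXn /= -[p`_d](_ : lead_coef p = _).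
    by rewrite (monicP mon_p) mul1r => /eqP; rewrite expf_eq0 (negbTE a_odd) andbF.
  by rewrite lead_coefE sp.
move=> i _; rewrite !rmorphM !rmorphXn /= (_ : 2%:~R = 0 :> 'F_2); last by apply/eqP.
by rewrite expr0n subn_eq0 leqNgt ltn_ord /= mulr0 mul0r.
Qed.

(** The parity of the numerator of [q] gives the sign of the 2-adic valuation of [s^3]. Cubes are
    compared because [s] itself need not be rational. *)
Lemma rat_cube_quarter_not_root (F : numFieldType) (g : {poly int}) (q : rat) (s : F) :
  g \is monic -> (g`_0)%:~R != 0 :> 'F_2 -> 4%:R * s ^+ 3 = ratr q ^+ 3 ->
  ~ root (map_poly intr g) s.
Proof.
move=> mon_g g0_odd s3 gs.
have evenP (a : int) : a%:~R = 0 :> 'F_2 -> exists b, a = 2 * b.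
  move/eqP; rewrite -(dvdz_pcharf (pchar_Fp (isT : prime 2))) => /dvdzP[b ->].
  by exists b; rewrite mulrC.
have s_int : integralOver intr s by exists g.
have intI (m : int) : integralOver intr (m%:~R : F) by exact: integral_id.
have intX (x : F) k : integralOver intr x -> integralOver intr (x ^+ k).
  move=> hx; elim: k => [|k IH]; first exact: (intI 1).
  by rewrite exprS; apply: integral_mul.
have den0 : (denq q)%:~R != 0 :> F by rewrite intr_eq0 denq_eq0.
have s3' : 4%:R * ((denq q)%:~R * s) ^+ 3 = (numq q)%:~R ^+ 3.
  by rewrite exprMn mulrCA s3 /ratr -exprMn mulrC divfK.
(* Either branch exhibits an odd integer that is twice an algebraic integer. *)
have [/evenP [a aE]|num_odd] := eqVneq ((numq q)%:~R : 'F_2) 0; last first.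
  apply: (@half_odd_not_integral F (numq q ^+ 3) (2%:R * ((denq q)%:~R * s) ^+ 3)).
  - by rewrite rmorphXn expf_neq0.
  - by apply: integral_mul; [exact: (intI 2) | apply/intX/integral_mul].
  - by rewrite rmorphXn /= -s3'; ring.
have den_odd : (denq q)%:~R != 0 :> 'F_2.
  apply/eqP => /evenP [b bE]; have := coprime_num_den q.
  by rewrite aE bE !abszM /coprime -muln_gcdr muln_eq1.
have bs3 : ((denq q)%:~R * s) ^+ 3 = 2%:R * a%:~R ^+ 3.
  have n4 : 4%:R != 0 :> F by rewrite pnatr_eq0.
  by apply: (mulfI n4); rewrite s3' aE rmorphM /=; ring.
(* At the root, [g]_0 = - h(s) s[; cubing and using]bs3[makes the odd integer](denq q * g[_0)^3]
   twice an algebraic integer. *)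
have [h gE] : exists h, g = h * 'X + (g`_0)%:P.
  elim/poly_ind: (g) => [|h c _]; first by exists 0; rewrite coef0 mul0r add0r.
  by exists h; rewrite coefD coefMX coefC add0r.
have /rootP := gs; rewrite gE rmorphD rmorphM /= map_polyX map_polyC /= !hornerE.
set hs := (_).[s] => /eqP; rewrite addrC addr_eq0 => /eqP g0E.
apply: (@half_odd_not_integral F ((denq q * g`_0) ^+ 3) (- (hs ^+ 3 * a%:~R ^+ 3))).
- by rewrite rmorphXn rmorphM expf_neq0 // mulf_neq0.
- apply/integral_opp/integral_mul; apply: intX => //.
  apply: integral_horner => //; apply/integral_poly => i; rewrite coef_map; exact: intI.
- rewrite rmorphXn rmorphM /= g0E.
  have -> : (denq q)%:~R * - (hs * s) = - (hs * ((denq q)%:~R * s)) by ring.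
  rewrite exprNn exprMn bs3; ring.
Qed.

(** * Symmetry under cube roots of unity *)

Section ThirdRootSymmetry.
Variables (C : numClosedFieldType) (Q : nat -> {poly C}).
Hypothesis HQ : yablonskii_vorobev Q.

Lemma scaled_yv_int (c : C) : c ^+ 3 = 4%:R -> forall n,
  [/\ c ^- 'C(n.+1, 2) *: (Q n \Po (c *: 'X)) = map_poly intr (yv_int n),
      yv_int n \is monic & yv_int n.+2 * yv_int n = yv_rhs (yv_int n.+1)].
Proof.
move=> c3; have c0 : c != 0.
  by apply/eqP => c0; move/eqP: c3; rewrite c0 expr0n eq_sym pnatr_eq0.
by have [T0 T1 TE] := scaled_recurrence _ _ _ c3 c0 HQ; apply: yv_int_spec.
Qed.

(** The cube roots [c] and [w * c] of 4 yield the same integer polynomial, so its constant term is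
    unchanged when multiplied by [w^-1]. Parity alone would not give exact vanishing. *)
Lemma yv_int_coef0 k : (yv_int (3 * k).+1)`_0 = 0.
Proof.
pose w : C := (sqrtC (- 3%:R) - 1) / 2%:R.
have n2 : 2%:R != 0 :> C by rewrite pnatr_eq0.
have w2 : w ^+ 2 = - w - 1.
  have := sqrtCK (- 3%:R : C); rewrite /w; move: (sqrtC _) => x x2.
  by rewrite expr_div_n sqrrB1 x2; field.
have w3 : w ^+ 3 = 1 by rewrite exprS w2 mulrBr mulr1 mulrN -expr2 w2; ring.
have w1 : w != 1.
  apply/eqP => w1; move/eqP: w2; rewrite w1 expr1n -subr_eq0.
  by rewrite (_ : 1 - _ = 3%:R) ?pnatr_eq0 //; ring.
pose c : C := 3.-root 4%:R.
have c3 : c ^+ 3 = 4%:R by rewrite rootCK.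
have wc3 : (w * c) ^+ 3 = 4%:R by rewrite exprMn w3 mul1r.
set n := (3 * k).+1.
have coef0E (d : C) : d ^+ 3 = 4%:R ->
    ((yv_int n)`_0)%:~R = d ^- 'C(n.+1, 2) * (Q n).[0].
  move=> d3; have [Tn _ _] := scaled_yv_int d d3 n.
  have := congr1 (fun p => p.[0]) Tn.
  by rewrite hornerZ horner_comp hornerZ hornerX mulr0 horner_coef0 coef_map.
(* For [n = 3k+1] the degree [n(n+1)/2] is 1 modulo 3. *)
have wn : w ^+ 'C(n.+1, 2) = w.
  have [m ->] : exists m, 'C(n.+1, 2) = (3 * m).+1.
    rewrite /n; elim: (k) => [|j [m mE]]; first by exists 0.
    exists (m + 3 * j.+1)%N; rewrite mulnS !addSn add0n.
    by rewrite binS bin1 binS bin1 binS bin1 mE; lia.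
  by rewrite exprS exprM w3 expr1n mulr1.
have := coef0E _ wc3; rewrite exprMn wn invfM -mulrA -(coef0E _ c3).
move=> E; apply/eqP; rewrite -(intr_eq0 C).
have /eqP : (1 - w^-1) * ((yv_int n)`_0)%:~R = 0 by rewrite mulrBl mul1r -E subrr.
by rewrite mulf_eq0 subr_eq0 eq_sym invr_eq1 (negbTE w1).
Qed.

End ThirdRootSymmetry.

Theorem theorem2 (R : realType) (Q : nat -> {poly R[i]})
    (HQ : yablonskii_vorobev Q) (n : nat) (z : R[i])
    (z_neq0 : z != 0) (Qnz : root (Q n) z) :
  ~ exists q : rat, z = ratr q.
Proof.
case=> q zq.
pose c : R[i] := 3.-root 4%:R.
have c3 : c ^+ 3 = 4%:R by rewrite rootCK.
have c0 : c != 0.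
  by apply/eqP => c0; move/eqP: c3; rewrite c0 expr0n eq_sym pnatr_eq0.
pose s := z / c.
have spec := scaled_yv_int _ _ HQ _ c3.
have s3 : 4%:R * s ^+ 3 = ratr q ^+ 3.
  by rewrite expr_div_n c3 -zq mulrC divfK // pnatr_eq0.
have root_s : root (map_poly intr (yv_int n)) s.
  have [<- _ _] := spec n; rewrite rootE hornerZ horner_comp hornerZ hornerX.
  by rewrite [c * s]mulrC divfK // (rootP Qnz) mulr0.
have [_ mon_n _] := spec n.
pose P m : {poly 'F_2} := map_poly intr (yv_int m).
have P0 : P 0%N = 1 by rewrite /P rmorph1.
have P1 : P 1%N = 'X by rewrite /P map_polyX.
have PE m : P m.+2 * P m = yv_rhs (P m.+1).
  by have [_ _ E] := spec m; rewrite -map_yv_rhs -E rmorphM.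
have [[a0 _ _ b1 _] c0'] := yv_mod2_spec _ P0 P1 PE (n %/ 3)%N.
rewrite !coef_map /= in a0 b1 c0'.
have : (n %% 3 < 3)%N by rewrite ltn_mod.
have := divn_eq n 3; rewrite mulnC.
case: (n %% 3)%N => [|[|[|//]]]; rewrite ?addn0 ?addn1 ?addn2 => nE _.
- by apply: (rat_cube_quarter_not_root _ _ q s mon_n _ s3) root_s; rewrite nE a0.
(* Divide out the root 0: the quotient has the odd linear coefficient as constant term, and still
   has the nonzero root [s]. *)
- have [g gE] : exists g, yv_int n = g * 'X.
    have := yv_int_coef0 _ _ HQ (n %/ 3); rewrite -nE.
    elim/poly_ind: (yv_int n) => [|h e _]; first by exists 0; rewrite mul0r.
    by rewrite coefD coefMX coefC add0r => /= ->; exists h; rewrite addr0.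
  rewrite gE in mon_n root_s.
  have mon_g : g \is monic by rewrite -(monicMr _ (monicX _)).
  apply: (rat_cube_quarter_not_root _ _ q s mon_g _ s3).
    by move: b1; rewrite -nE gE coefMX /= => ->.
  move: root_s; rewrite rmorphM /= map_polyX rootM => /orP[//|].
  by rewrite rootE hornerX mulf_eq0 invr_eq0 (negbTE z_neq0) (negbTE c0).
- by apply: (rat_cube_quarter_not_root _ _ q s mon_n _ s3) root_s; rewrite nE c0'.
Qed.
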